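(* The map $\dim_{ML}\colon\mathcal{F}(\ell^1)\to[0,\infty]$, $F\mapsto\dim_{ML}F$, is not Borel measurable; that is, it is not measurable with respect to the $\sigma$-algebra $\mathcal{B}$ on $\mathcal{F}(\ell^1)$ (the Effros Borel structure) and the Borel $\sigma$-algebra of $[0,\infty]$.
   Context: Subsets of a metric space are regarded as metric spaces with the inherited metric. For a metric space $(X,\rho)$, $B(x,r)=\{y\in X:\rho(x,y)\le r\}$ denotes the closed ball in $X$, and $N_r(A)\in\{0,1,2,\dots\}\cup\{\infty\}$ denotes the minimal number of sets of diameter at most $r$ required to cover $A\subset X$. The lower dimension of a metric space $X$ with at least two points is $$\dim_L X=\sup\Big\{\alpha\in\mathbb{R}:\ \exists\, C>0 \text{ such that for all real } 0<r<R\le\operatorname{diam}X \text{ and all } x\in X,\ N_r(B(x,R))\ge C\left(\tfrac{R}{r}\right)^{\alpha}\Big\}\in[0,\infty],$$ where $\operatorname{diam}X$ may be $\infty$. Conventions: $\dim_L\emptyset=0$, and $\dim_L X=0$ if $X$ is a one-point space. The modified lower dimension of a metric space $X$ is $\dim_{ML}X=\sup\{\dim_L E: E\subset X\}$. $\ell^1=\{x\in\mathbb{R}^\omega:\sum_{n=0}^\infty|x(n)|<\infty\}$ is equipped with the norm $\|x\|=\sum_{n=0}^\infty|x(n)|$ and the induced metric. $\mathcal{F}(\ell^1)$ is the set of closed subsets of $\ell^1$, endowed with the $\sigma$-algebra $\mathcal{B}$ generated by the sets $\{F\in\mathcal{F}(\ell^1):F\cap U\ne\emptyset\}$, where $U$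 runs over the open subsets of $\ell^1$. *)

(* Defs.v *)
From HB Require Import structures.
From mathcomp Require Import all_boot all_order all_algebra.
From mathcomp Require Import all_classical all_reals all_analysis.
From mathcomp Require Import measurable_realfun.

Set Implicit Arguments.
Unset Strict Implicit.
Unset Printing Implicit Defensive.

Import Order.TTheory GRing.Theory Num.Theory.
Import numFieldNormedType.Exports.

Local Open Scope classical_set_scope.
Local Open Scope ring_scope.

(* A set E : set M in a metric space M stands for the metric space E with the
   inherited metric; closed balls of E are the traces on E of those of M.     *)
Section lower_dimension.
Context {R : realType} {M : metricType R}.
Implicit Types (A E : set M) (x : M) (r s a : R).

(* The library's closed_ball is the closure of the open ball, which in a
   general metric space is smaller than {y | d(x, y) <= r}.                   *)
Definition cball x r : set M := [set y | mdist x y <= r].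

(* The maximum with 0 only affects the empty set. *)
Definition diam A : \bar R :=
  Order.max 0%E (ereal_sup [set (mdist p.1 p.2)%:E | p in A `*` A]).

(* +oo (the infimum of set0) when no finite cover exists. The covering sets may
   be arbitrary subsets of M: intersecting them with A (or with any space
   containing A) does not increase their diameters.                           *)
Definition covering_number r A : \bar R :=
  ereal_inf [set (n%:R)%:E | n in [set n : nat | exists U : (set M)^nat,
    (forall i, (i < n)%N -> (diam (U i) <= r%:E)%E) /\
    A `<=` \bigcup_(i < n) U i]].

Definition lower_exponent E : set R :=
  [set a | exists2 C : R, 0 < C &
    forall r s, 0 < r -> r < s -> (s%:E <= diam E)%E ->
    forall x, E x ->
      ((C * (s / r) `^ a)%:E <= covering_number r (E `&` cball x s))%E].

Definition dimL E : \bar R :=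
  if `[< exists x y, [/\ E x, E y & x <> y] >]
  then ereal_sup [set a%:E | a in lower_exponent E] else 0%E.

Definition dimML E : \bar R :=
  ereal_sup [set dimL A | A in [set A | A `<=` E]].

Lemma dimL_ge0 E : (0 <= dimL E)%E.
Proof.
rewrite /dimL; case: asboolP => // _.
apply: ereal_sup_ubound; exists 0 => //; exists 1 => //.
move=> r s r0 rs sE x Ex; rewrite powRr0 mulr1.
apply: le_ereal_inf_tmp => _ [[|n] [U [_ EU]] <-]; last first.
  by rewrite lee_fin ler1n.
have Bx : (E `&` cball x s) x.
  by split => //; rewrite /cball/= mdistxx (ltW (lt_trans r0 rs)).
by have [i] := EU _ Bx.
Qed.

Lemma dimML_ge0 E : (0 <= dimML E)%E.
Proof.
apply: le_trans (dimL_ge0 set0) _; apply: ereal_sup_ubound.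
by exists set0 => //=; exact: sub0set.
Qed.

End lower_dimension.

Section ell1_pred.
Context {R : realType}.

Definition ell1_enorm (x : nat -> R) : \bar R :=
  (\sum_(0 <= n <oo) `|x n|%:E)%E.

Definition in_ell1 : {pred nat -> R} := [pred x | (ell1_enorm x < +oo)%E].

Lemma ell1_enorm_ge0 x : (0 <= ell1_enorm x)%E.
Proof. by apply: nneseries_ge0 => n _ _; rewrite lee_fin. Qed.

Lemma ell1_enormZ (a : R) x :
  ell1_enorm (a *: x) = (`|a|%:E * ell1_enorm x)%E.
Proof.
rewrite /ell1_enorm -nneseriesZl//.
by apply: eq_eseriesr => n _; rewrite -EFinM -normrM.
Qed.

Lemma ell1_enormD x y :
  (ell1_enorm (x + y)%R <= ell1_enorm x + ell1_enorm y)%E.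
Proof.
rewrite /ell1_enorm -nneseriesD//.
apply: lee_nneseries => n *; first by rewrite lee_fin.
by rewrite -EFinD lee_fin; exact: ler_normD.
Qed.

Lemma ell1_submod_closed : submod_closed in_ell1.
Proof.
split.
  by rewrite inE /ell1_enorm eseries0// => n _ _; rewrite normr0.
move=> a x y; rewrite !inE => xoo yoo.
rewrite (le_lt_trans (ell1_enormD _ _))// lte_add_pinfty// ell1_enormZ.
by rewrite lte_mul_pinfty// lee_fin.
Qed.

HB.instance Definition _ :=
  GRing.isSubmodClosed.Build R (nat -> R) in_ell1 ell1_submod_closed.

End ell1_pred.

Record ell1 (R : realType) :=
  Ell1 { ell1_seq :> nat -> R; _ : ell1_seq \in in_ell1 }.

Section ell1_normed.
Context {R : realType}.
Implicit Types x y : ell1 R.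

HB.instance Definition _ := [isSub for @ell1_seq R].
HB.instance Definition _ := [Choice of ell1 R by <:].
HB.instance Definition _ := [SubChoice_isSubLmodule of ell1 R by <:].

Definition ell1_norm x : R := fine (ell1_enorm x).

Lemma ell1_enormE x : ell1_enorm x = (ell1_norm x)%:E.
Proof.
rewrite fineK// ge0_fin_numE ?ell1_enorm_ge0//.
exact: (valP x).
Qed.

Lemma ler_ell1_normD x y : ell1_norm (x + y) <= ell1_norm x + ell1_norm y.
Proof. by rewrite -lee_fin EFinD -!ell1_enormE; exact: ell1_enormD. Qed.

Lemma ell1_normZ (a : R) x : ell1_norm (a *: x) = `|a| * ell1_norm x.
Proof.
by apply: EFin_inj; rewrite EFinM -!ell1_enormE; exact: ell1_enormZ.
Qed.

Lemma ell1_norm0_eq0 x : ell1_norm x = 0 -> x = 0.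
Proof.
move=> x0; apply/val_inj/funext => n; apply/eqP.
rewrite -normr_eq0 eq_le normr_ge0 andbT -lee_fin -x0 -ell1_enormE.
rewrite /ell1_enorm (nneseriesD1 (n := n))//= leeDl//.
exact: nneseries_ge0.
Qed.

HB.instance Definition _ := Lmodule_isNormed.Build R (ell1 R)
  ler_ell1_normD ell1_normZ ell1_norm0_eq0.

Definition ell1_dist x y : R := `|x - y|.

Lemma ell1_dist_ge0 x y : 0 <= ell1_dist x y.
Proof. exact: normr_ge0. Qed.

Lemma ell1_dist_positivity x y : ell1_dist x y = 0 -> x = y.
Proof. by move=> /eqP; rewrite /ell1_dist normr_eq0 subr_eq0 => /eqP. Qed.

Lemma ell1_ballE x (d : R) : ball x d = [set y | ell1_dist x y < d].
Proof. by rewrite -ball_normE. Qed.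

HB.instance Definition _ := PseudoMetric_isMetric.Build R (ell1 R)
  ell1_dist_ge0 ell1_dist_positivity ell1_ballE.

End ell1_normed.

Section effros.
Variable T : topologicalType.

Definition closed_subset := {F : set T | closed F}.

HB.instance Definition _ := gen_eqMixin closed_subset.
HB.instance Definition _ := gen_choiceMixin closed_subset.
HB.instance Definition _ := isPointed.Build closed_subset
  (exist _ set0 (@closed0 T)).

Definition hitting_sets : set (set closed_subset) :=
  [set [set F : closed_subset | sval F `&` U !=set0] | U in open].

(* Measurable sets: the sigma-algebra generated by hitting_sets. *)
Definition effros := g_sigma_algebraType hitting_sets.

End effros.

(* Main.v *)
(* To a point x of the Cantor space, viewed as a code for a tree T_x, attach the
   closure F_x of the set of vectors node s, where s runs over the finite
   sequences lying over T_x. The x for which F_x meets a given open set form a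
   countable union of clopen sets, so x |-> F_x pulls Borel families of closed
   sets back to sets that are both analytic and coanalytic.
   If T_x has an infinite branch, the nodes over it form a subset of F_x where
   every ball of radius s contains infinitely many points at mutual distance of
   order s, so that dim_ML F_x >= 1. If T_x has no infinite branch, a subset of
   F_x without isolated points would pass through longer and longer sequences
   and so produce a branch; since positive lower dimension excludes isolated
   points, dim_ML F_x = 0. Hence measurability of dim_ML would make
   {x | T_x has an infinite branch} coanalytic, contrary to a diagonalization. *)

Require Import Defs.
From mathcomp Require Import all_boot all_order all_algebra.
From mathcomp Require Import all_classical all_reals all_analysis.
From mathcomp Require Import measurable_realfun lra.

Set Implicit Arguments.
Unset Strict Implicit.
Unset Printing Implicit Defensive.

Import Order.TTheory GRing.Theory Num.Theory.
Import numFieldNormedType.Exports.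

Local Open Scope classical_set_scope.
Local Open Scope ring_scope.

(** * Analytic subsets of the Cantor space *)

Definition agree {T} n (x x' : nat -> T) := forall i, (i < n)%N -> x' i = x i.

Lemma agree_mkseq T n (x x' : nat -> T) :
  agree n x x' <-> mkseq x' n = mkseq x n.
Proof.
split=> [xx'|xx' i ni].
  by apply/eq_in_map => i; rewrite mem_iota => /andP[_ ni]; exact: xx'.
have := congr1 (fun s => nth (x i) s i) xx'.
by rewrite !nth_mkseq.
Qed.

Lemma agree_le T m n (x x' : nat -> T) :
  (m <= n)%N -> agree n x x' -> agree m x x'.
Proof. by move=> mn xx' i im; apply: xx'; exact: leq_trans mn. Qed.

(** Closedness in the product of the Cantor and Baire spaces, in terms of basic neighbourhoods; the
    projections of such relations are the analytic sets. *)
Definition closed_rel (K : (nat -> bool) -> (nat -> nat) -> Prop) :=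
  forall x y,
    (forall n, exists x' y', [/\ K x' y', agree n x x' & agree n y y']) ->
    K x y.

Definition analytic (A : set (nat -> bool)) :=
  exists2 K, closed_rel K & forall x, A x <-> exists y, K x y.

Definition locally_constant (A : set (nat -> bool)) :=
  forall x, exists n, forall x', agree n x x' -> (A x' <-> A x).

Lemma locally_constant_analytic A : locally_constant A -> analytic A.
Proof.
move=> lcA; exists (fun x _ => A x) => [x y xy|x].
  have [n nA] := lcA x; have [x' [_ [Ax' xx' _]]] := xy n.
  exact/(nA _ xx').
by split=> [Ax|[]//]; exists (fun=> 0%N).
Qed.

Lemma locally_constantC A : locally_constant A -> locally_constant (~` A).
Proof.
move=> lcA x; have [n nA] := lcA x; exists n => x' /nA xx'.
by split=> + Ax; apply; exact/xx'.
Qed.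

(** The first entry of a witness selects a member of the union, and its tail is a witness for that
    member. *)
Lemma analytic_bigcup (A : (set (nat -> bool))^nat) :
  (forall m, analytic (A m)) -> analytic (\bigcup_m A m).
Proof.
move=> /(_ _)/cid2-/all_sig2[K clK AK].
exists (fun x y => K (y 0%N) x (y \o S)) => [x y xy|x].
  apply: clK => n; have [x' [y' [Kx'y' xx' yy']]] := xy n.+1.
  exists x', (y' \o S); split.
  - by rewrite -(yy' 0%N).
  - exact: agree_le xx'.
  - by move=> i ni; exact: yy'.
split=> [[m _ /AK[y Kxy]]|[y Kxy]].
  by exists (fun i => if i is j.+1 then y j else m).
by exists (y 0%N) => //; apply/AK; exists (y \o S).
Qed.

(** One sequence carries witnesses for all members at once, the [m]-th being its row at the codes of
    the pairs [(m, i)]. *)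
Lemma analytic_bigcap (A : (set (nat -> bool))^nat) :
  (forall m, analytic (A m)) -> analytic (\bigcap_m A m).
Proof.
move=> /(_ _)/cid2-/all_sig2[K clK AK].
exists (fun x y => forall m, K m x (fun i => y (pickle (m, i)))) =>
    [x y xy m|x].
  apply: clK => n.
  (* [N] exceeds the codes of all [(m, i)] with [i < n], so agreement up to [N] gives agreement of
     the [m]-th rows up to [n]. *)
  pose N := maxn n (\max_(i < n) (pickle (m, i : nat)).+1).
  have [x' [y' [Kx'y' xx' yy']]] := xy N.
  exists x', (fun i => y' (pickle (m, i))); split => //.
    by apply: agree_le xx'; exact: leq_maxl.
  move=> i ni; apply: yy'; rewrite leq_max; apply/orP; right.
  exact: (leq_bigmax (F := fun i : 'I_n => (pickle (m, i : nat)).+1)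
    (Ordinal ni)).
split=> [Ax|[y Kxy] m _]; last by apply/AK; eexists; exact: Kxy.
have /(_ _)/cid-/all_sig[y Ky] : forall m, exists y, K m x y.
  by move=> m; apply/AK/Ax.
exists (fun k => if unpickle k is Some (m, i) then y m i else 0%N) => m.
by under eq_fun do rewrite pickleK; exact: Ky.
Qed.

(** The sets whose preimage is both analytic and coanalytic form a sigma-algebra. *)
Lemma analytic_preimage_measurable d (T : measurableType d)
    (G : set (set T)) (f : (nat -> bool) -> T) :
  (@measurable d T `<=` <<s G >>) ->
  (forall B, G B -> analytic (f @^-1` B) /\ analytic (~` (f @^-1` B))) ->
  forall B, measurable B -> analytic (f @^-1` B).
Proof.
move=> sG fG B /sG mB.
suff [] : [set B | analytic (f @^-1` B) /\ analytic (~` (f @^-1` B))] B by [].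
move: B mB; apply: smallest_sub => //; split => /=.
- rewrite preimage_set0 setC0.
  by split; apply: locally_constant_analytic => x; exists 0%N.
- by move=> B [fB fCB]; rewrite setTD preimage_setC setCK.
- move=> F fF; rewrite preimage_bigcup setC_bigcup; split.
    by apply: analytic_bigcup => n; case: (fF n).
  by apply: analytic_bigcap => n; case: (fF n).
Qed.

(* A sequence x codes a closed relation, whose sections are the branches of a
   tree; this is the diagonal of the resulting universal analytic set. *)
Definition diagonal_analytic : set (nat -> bool) :=
  [set x : nat -> bool | exists y : nat -> nat,
    forall n, x (pickle (mkseq x n, mkseq y n))].

(** If the complement were the projection of [K], the code of the tree of [K] would lie in
    [diagonal_analytic] exactly when it does not. *)
Lemma diagonal_analytic_coanalytic : ~ analytic (~` diagonal_analytic).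
Proof.
move=> [K clK AK].
(* [S] is the tree of finite approximations to points of [K], and [x] is its characteristic
   function. *)
pose S (st : seq bool * seq nat) := exists x y,
  [/\ K x y, mkseq x (size st.1) = st.1 & mkseq y (size st.2) = st.2].
pose x k := if unpickle k is Some st then `[< S st >] else false.
suff xK : diagonal_analytic x <-> exists y, K x y.
  have Ax : diagonal_analytic x.
    by apply: contrapT => nAx; apply: (nAx); apply/xK/AK.
  by have /xK/AK := Ax.
have xE y n : x (pickle (mkseq x n, mkseq y n)) <-> exists x' y',
    [/\ K x' y', agree n x x' & agree n y y'].
  rewrite /x pickleK; split=> [/asboolP|] [x' [y' []]].
    rewrite !size_mkseq => Kx'y' xx' yy'.
    by exists x', y'; split=> //; apply/agree_mkseq.
  move=> Kx'y' /agree_mkseq xx' /agree_mkseq yy'.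
  by apply/asboolP; exists x', y'; rewrite !size_mkseq.
split=> -[y xy]; exists y.
  by apply: clK => n; apply/xE; exact: xy.
by move=> n; apply/xE; exists x, y; split.
Qed.

(** * Criteria for the lower dimension *)

Section lower_dimension_criteria.
Context {R : realType} {M : metricType R}.
Implicit Types (E : set M) (p : M) (a c e : R).

Lemma covering_number_cst_le1 p c : 0 <= c ->
  (covering_number c [set p] <= 1)%E.
Proof.
move=> c0; apply: ereal_inf_lbound; exists 1%N => //; exists (fun=> [set p]).
split=> [i _|_ ->]; last by exists 0%N.
rewrite /diam ge_max lee_fin c0/=.
by apply: ge_ereal_sup => _ [[u v] /= [-> ->] <-]; rewrite mdistxx lee_fin.
Qed.

Lemma mdist_le_diam E p q : E p -> E q -> ((mdist p q)%:E <= diam E)%E.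
Proof.
move=> Ep Eq; rewrite /diam le_max; apply/orP; right.
by apply: ereal_sup_ubound; exists (p, q).
Qed.

Lemma lower_exponent_no_isolated E a p0 q0 : 0 < a -> lower_exponent E a ->
  E p0 -> E q0 -> p0 != q0 ->
  forall p e, E p -> 0 < e -> exists q, [/\ E q, q != p & mdist p q <= e].
Proof.
move=> a0 [C C0 CE] Ep0 Eq0 pq p e Ep e0; apply: contrapT => isolated.
pose s := Num.min e (mdist p0 q0).
have s0 : 0 < s by rewrite lt_min e0 mdist_gt0.
have sE : (s%:E <= diam E)%E.
  by apply: le_trans (mdist_le_diam Ep0 Eq0); rewrite lee_fin ge_min lexx orbT.
have Eps : E `&` cball p s = [set p].
  apply/seteqP; split=> [q [Eq /= pqs]|_ ->]; last first.
    by split => //=; rewrite /cball/= mdistxx ltW.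
  apply: contrapT => /eqP qp; apply: isolated; exists q; split=> //.
  by apply: le_trans pqs _; rewrite ge_min lexx.
pose k := Num.max 2 ((2 / C) `^ a^-1).
have k1 : 1 < k by rewrite lt_max ltr1n.
have k0 : 0 < k by apply: lt_trans k1.
have sk0 : 0 < s / k by rewrite divr_gt0.
have sks : s / k < s by rewrite ltr_pdivrMr// ltr_pMr.
have := CE _ _ sk0 sks sE _ Ep; rewrite Eps => /le_trans.
move=> /(_ _ (covering_number_cst_le1 _ (ltW sk0))).
rewrite invf_div mulrCA divff ?gt_eqF// mulr1 lee_fin.
apply/negP; rewrite -ltNge.
suff : 2 / C <= k `^ a.
  by rewrite ler_pdivrMr// mulrC; apply: lt_le_trans; rewrite ltr1n.
have -> : 2 / C = ((2 / C) `^ a^-1) `^ a.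
  by rewrite -powRrM mulVf ?lt0r_neq0// powRr1// divr_ge0// ltW.
by rewrite ge0_ler_powR ?nnegrE ?powR_ge0// ?le_max ?lexx ?orbT// ltW.
Qed.

(** If [s / r > c], a set of diameter at most [r] contains at most one [u j], so no finite cover
    exists; if [s / r <= c], the constant [c^-1] reduces the bound to 1. *)
Lemma lower_exponent1_separated E c : 0 < c ->
  (forall p s, E p -> 0 < s -> (s%:E <= diam E)%E ->
     exists u : nat -> M, (forall j, E (u j) /\ mdist p (u j) <= s) /\
       (forall i j, i != j -> s < c * mdist (u i) (u j))) ->
  lower_exponent E 1.
Proof.
move=> c0 Eu; exists c^-1; first by rewrite invr_gt0.
move=> r s r0 rs sE p Ep; have s0 := lt_trans r0 rs.
have [u [uE usep]] := Eu _ _ Ep s0 sE.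
apply: le_ereal_inf_tmp => _ [n [U [Ur EU]] <-]; rewrite lee_fin.
rewrite powRr1; last by rewrite divr_ge0 ?(ltW s0) ?(ltW r0).
have /choice[f fU] : forall j, exists i, (i < n)%N /\ U i (u j).
  move=> j; have [|i /= ni Uij] := EU (u j); last by exists i.
  by case: (uE j).
have n0 : (0 < n)%N by apply: leq_ltn_trans (fU 0%N).1.
have [sr|sr] := leP (s / r) c.
  apply: (@le_trans _ _ (1 : R)); last by rewrite ler1n.
  by rewrite mulrC ler_pdivrMr// mul1r.
pose F (i : 'I_n.+1) := Ordinal (fU i).1.
suff /leq_card : injective F by rewrite !card_ord ltnn.
move=> i j Fij; apply/val_inj/eqP; apply: contraT => /usep.
have Uj : U (f i) (u j) by rewrite (congr1 val Fij : f i = f j); case: (fU j).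
have : ((mdist (u i) (u j))%:E <= r%:E)%E.
  by apply: le_trans (Ur _ (fU i).1); apply: mdist_le_diam => //; case: (fU i).
rewrite lee_fin => uij.
rewrite ltNge; apply: contraNT => _; apply: ltW.
apply: le_lt_trans (_ : c * r < s); first by rewrite ler_wpM2l// ltW.
by rewrite -ltr_pdivlMr.
Qed.

End lower_dimension_criteria.

(** * An embedding of finite sequences into the space of summable sequences *)

Section ell1_units.
Context {R : realType}.
Implicit Types x y : ell1 R.

Let unit_seq n : nat -> R := fun i => (i == n)%:R.

Lemma unit_seq_enorm n : ell1_enorm (unit_seq n) = 1%E.
Proof.
rewrite /ell1_enorm (nneseriesD1 (n := n))//.
rewrite eseries0 => [|i _ /= /negPf].
  by rewrite /unit_seq eqxx normr1 adde0.
by rewrite /unit_seq => ->; rewrite normr0.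
Qed.

Lemma unit_seq_in_ell1 n : unit_seq n \in in_ell1.
Proof. by rewrite inE unit_seq_enorm ltry. Qed.

Definition ell1_unit n : ell1 R := Ell1 (unit_seq_in_ell1 n).

Lemma ell1_unitE n i : ell1_unit n i = (i == n)%:R. Proof. by []. Qed.

Lemma norm_ell1_unit n : `|ell1_unit n| = 1.
Proof. by apply: EFin_inj; rewrite -ell1_enormE unit_seq_enorm. Qed.

Lemma ell1D x y i : (x + y) i = x i + y i. Proof. by []. Qed.

Lemma ell1B x y i : (x - y) i = x i - y i. Proof. by []. Qed.

Lemma ell1Z (a : R) x i : (a *: x) i = a * x i. Proof. by []. Qed.

Lemma coord_le_norm x i : `|x i| <= `|x|.
Proof.
rewrite -lee_fin -[leRHS]ell1_enormE /ell1_enorm (nneseriesD1 (n := i))//=.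
rewrite leeDl//.
exact: nneseries_ge0.
Qed.

Lemma ell1P x y : (forall i, x i = y i) -> x = y.
Proof. by move=> xy; apply/val_inj/funext. Qed.

Lemma ell1_mdistE x y : mdist x y = `|x - y|. Proof. by []. Qed.

Lemma ell1_closureP (D : set (ell1 R)) x (e : R) : closure D x -> 0 < e ->
  exists2 y, D y & `|x - y| < e.
Proof.
move=> + e0 => /(_ (ball x e) (nbhsx_ballx _ _ e0))[y [Dy]].
by rewrite -ball_normE; exists y.
Qed.

End ell1_units.

(* A letter (a, (m, j)) moves one step along the branch a; m controls the
   distance to the previous node, and j provides infinitely many equidistant
   nodes at this distance. *)
Definition letter := (nat * (nat * nat))%type.

Section nodes.
Context {R : realType}.
Implicit Types (s t u : seq letter) (c : letter).

(** The successor makes every letter raise the level, so weights drop by a factor of at least 4 per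
    letter. *)
Definition level s := sumn [seq c.2.1.+1 | c <- s].

Definition weight s : R := 4 ^- level s.

(** Each prefix of [s] has its own coordinate, so the nonzero coordinates of a node record its
    prefixes. *)
Definition node s : ell1 R :=
  \sum_(k < (size s).+1) weight (take k s) *: ell1_unit (pickle (take k s)).

Lemma level_rcons s c : level (rcons s c) = (level s + c.2.1.+1)%N.
Proof. by rewrite /level map_rcons sumn_rcons. Qed.

Lemma weight_gt0 s : 0 < weight s.
Proof. by rewrite invr_gt0 exprn_gt0. Qed.

Lemma weight_rcons s c : weight (rcons s c) <= weight s / 4.
Proof.
rewrite /weight level_rcons -invfM -exprSr lef_pV2 ?posrE ?exprn_gt0//.
by rewrite ler_eXn2l ?ltr1n// -addn1 leq_add2l.
Qed.

Lemma node_nil :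
  node [::] = weight [::] *: ell1_unit (pickle ([::] : seq letter)).
Proof. by rewrite /node big_ord1. Qed.

Lemma node_rcons s c :
  node (rcons s c) =
  node s + weight (rcons s c) *: ell1_unit (pickle (rcons s c)).
Proof.
rewrite /node size_rcons big_ord_recr /= take_oversize ?size_rcons//.
congr (_ + _); apply: eq_bigr => k _.
by rewrite -cats1 takel_cat// -ltnS.
Qed.

Lemma prefix_of_rcons s u c :
  prefix u (rcons s c) = prefix u s || (u == rcons s c).
Proof.
apply/idP/idP => [|/orP[us|/eqP->]]; last exact: prefix_refl.
  move=> /prefixP[t]; case/lastP: t => [|t c'].
    by rewrite cats0 => ->; rewrite eqxx orbT.
  by rewrite -rcons_cat => /rcons_inj[-> _]; rewrite prefix_prefix.
by rewrite -cats1; exact: prefix_catl.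
Qed.

Lemma node_coord s u :
  node s (pickle u) = if prefix u s then weight u else 0.
Proof.
elim/last_ind: s => [|s c IHs].
  rewrite node_nil ell1Z ell1_unitE (inj_eq (pcan_inj pickleK)) prefixs0.
  by case: eqP => [->|_]; rewrite ?mulr1 ?mulr0.
rewrite node_rcons ell1D ell1Z ell1_unitE IHs (inj_eq (pcan_inj pickleK)).
rewrite prefix_of_rcons; case: (eqVneq u (rcons s c)) => [->|_].
  rewrite mulr1 orbT; case: ifP; last by rewrite add0r.
  by move=> /size_prefix; rewrite size_rcons ltnn.
by rewrite mulr0 addr0 orbF.
Qed.

Lemma node_coord_out s i :
  (forall u : seq letter, i != pickle u) -> node s i = 0.
Proof.
move=> iu; elim/last_ind: s => [|s c IHs].
  by rewrite node_nil ell1Z ell1_unitE (negPf (iu _)) mulr0.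
by rewrite node_rcons ell1D ell1Z ell1_unitE IHs (negPf (iu _)) mulr0 addr0.
Qed.

Lemma node_rcons_dist s c : `|node (rcons s c) - node s| = weight (rcons s c).
Proof.
rewrite node_rcons addrC addKr normrZ norm_ell1_unit mulr1.
by rewrite gtr0_norm ?weight_gt0.
Qed.

(** The steps after [s] are dominated by the geometric series 1/4 + 1/16 + ... = 1/3. *)
Lemma node_cat_dist s t : `|node (s ++ t) - node s| <= weight s / 3.
Proof.
elim: t s => [|c t IHt] s.
  by rewrite cats0 subrr normr0 divr_ge0 ?ltW ?weight_gt0.
rewrite -cat_rcons -(subrKA (node (rcons s c))).
apply: le_trans (ler_normD _ _) _; rewrite node_rcons_dist.
have := weight_rcons s c; have := IHt (rcons s c); lra.
Qed.

Lemma node_sep s t : ~~ prefix s t -> weight s <= `|node s - node t|.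
Proof.
move=> st; apply: le_trans (coord_le_norm _ (pickle s)).
by rewrite ell1B !node_coord prefix_refl (negPf st) subr0 ler_norm.
Qed.

(** Cut [s] before the letter that brings the level to [N]: this letter costs at most [4 ^- N], and
    the rest at most a third of that. *)
Lemma node_truncation N s : (0 < N)%N ->
  exists p t, [/\ s = p ++ t, (level p < N)%N &
    `|node s - node p| <= 4 / 3 * 4 ^- N].
Proof.
move=> N0; have N4 : 0 <= 4 ^- N :> R by rewrite invr_ge0 exprn_ge0.
suff [sN|[p [c [t [-> pN cN]]]]] : (level s < N)%N \/ exists p c t,
    [/\ s = p ++ c :: t, (level p < N)%N & (N <= level (rcons p c))%N].
- by exists s, [::]; rewrite cats0 subrr normr0; split=> //; lra.
- exists p, (c :: t); split=> //.
  rewrite -cat_rcons -(subrKA (node (rcons p c))).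
  apply: le_trans (ler_normD _ _) _; rewrite node_rcons_dist.
  have : weight (rcons p c) <= 4 ^- N.
    by rewrite lef_pV2 ?posrE ?exprn_gt0// ler_eXn2l ?ltr1n.
  have := node_cat_dist (rcons p c) t; lra.
elim/last_ind: s => [|s c [sN|[p [c' [t [-> pN cN]]]]]]; first by left.
  have [cN|cN] := ltnP (level (rcons s c)) N; first by left.
  by right; exists s, c, [::]; rewrite cats1.
by right; exists p, c', (rcons t c); split=> //; rewrite rcons_cat.
Qed.

End nodes.

(** * The closed set attached to a tree *)

Lemma prefix_comparable (T : eqType) (u v s : seq T) :
  prefix u s -> prefix v s -> prefix u v || prefix v u.
Proof.
rewrite !prefixE; move: u v.
suff H (u v : seq T) : (size u <= size v)%N ->
    take (size u) s == u -> take (size v) s == v -> take (size u) v == u.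
  move=> u v us vs; have [uv|/ltnW vu] := leqP (size u) (size v).
    by rewrite H.
  by rewrite (H v u) ?orbT.
by move=> uv us /eqP<-; rewrite take_takel.
Qed.

Lemma take_mkseq T (f : nat -> T) k n :
  (k <= n)%N -> take k (mkseq f n) = mkseq f k.
Proof. by move=> kn; rewrite /mkseq -map_take take_iota (minn_idPl kn). Qed.

(** * Coordinates of limits of nodes *)

Section node_closure.
Context {R : realType}.
Variable D : set (seq letter).
Implicit Types (p : ell1 R) (s u v : seq letter).

Local Notation cl := (closure (@node R @` D)).

Lemma closure_node_coord01 p u : cl p ->
  p (pickle u) = 0 \/ p (pickle u) = weight u.
Proof.
move=> Dp; apply: contrapT => /not_orP[p0 pw].
pose e := Num.min `|p (pickle u)| `|p (pickle u) - weight u|.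
have e0 : 0 < e.
  by rewrite lt_min !normr_gt0 subr_eq0; apply/andP; split; apply/eqP.
have [_ [s Ds <-]] := ell1_closureP Dp e0.
apply/negP; rewrite -leNgt; apply: le_trans (coord_le_norm _ (pickle u)).
rewrite ell1B node_coord ge_min; case: ifP => _; first by rewrite lexx orbT.
by rewrite subr0 lexx.
Qed.

(** By the dichotomy above, a node closer to [p] than both weights must agree with [p] at both
    coordinates. *)
Lemma closure_node_coord p u v : cl p -> exists s, [/\ D s,
  p (pickle u) = node s (pickle u) & p (pickle v) = node s (pickle v)].
Proof.
move=> Dp; pose e : R := Num.min (weight u) (weight v).
have e0 : 0 < e by rewrite lt_min !weight_gt0.
have [_ [s Ds <-] ps] := ell1_closureP Dp e0.
suff H w : e <= weight w -> p (pickle w) = node s (pickle w).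
  by exists s; split => //; apply: H; rewrite ge_min lexx ?orbT.
move=> ew; have := le_lt_trans (coord_le_norm _ (pickle w)) (lt_le_trans ps ew).
rewrite ell1B node_coord.
have w0 : `|weight w| = weight w :> R by rewrite gtr0_norm ?weight_gt0.
have [->|->] := closure_node_coord01 w Dp; case: ifP => // _.
  by rewrite sub0r normrN w0 ltxx.
by rewrite subr0 w0 ltxx.
Qed.

Lemma closure_node_coord_out p i : cl p ->
  (forall u : seq letter, i != pickle u) -> p i = 0.
Proof.
move=> Dp iu; apply/eqP; rewrite -normr_le0 leNgt; apply/negP => pi0.
have [_ [s Ds <-]] := ell1_closureP Dp pi0.
apply/negP; rewrite -leNgt; apply: le_trans (coord_le_norm _ i).
by rewrite ell1B node_coord_out ?subr0.
Qed.

Lemma weight_neq0 u : weight u != 0 :> R.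
Proof. by rewrite gt_eqF ?weight_gt0. Qed.

Lemma node_coord_neq0 s u : (@node R s (pickle u) != 0) = prefix u s.
Proof.
by rewrite node_coord; case: ifP => _; rewrite ?weight_neq0 ?eqxx.
Qed.

(** Any two coordinates of [p] are read off one node, so the sequences with nonzero coordinate form
    a chain; if it ends at [u], it consists of the prefixes of [u]. *)
Lemma closure_node_maximal p u : cl p -> p (pickle u) != 0 ->
  (forall v, prefix u v -> v != u -> p (pickle v) = 0) -> p = node u.
Proof.
move=> Dp pu max_u; apply: ell1P => i.
have [[v ->]|iv] := pselect (exists v : seq letter, i = pickle v); last first.
  have {}iv v : i != pickle v by apply/eqP => iE; apply: iv; exists v.
  by rewrite closure_node_coord_out ?node_coord_out.
have [s [Ds psu psv]] := closure_node_coord u v Dp.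
move: pu; rewrite psu node_coord_neq0 => us.
rewrite node_coord; case: ifPn => vu.
  by rewrite psv node_coord (prefix_trans vu us).
have [vs|vs] := boolP (prefix v s); last by rewrite psv node_coord (negPf vs).
apply: max_u.
  by have := prefix_comparable us vs; rewrite (negPf vu) orbF.
by apply: contraNneq vu => ->; exact: prefix_refl.
Qed.

(* If p is not isolated in E and passes through u, a close enough q also passes
   through u; they cannot both end at u. *)
Lemma no_isolated_extension (E : set (ell1 R)) u : E `<=` cl ->
  (forall p e, E p -> 0 < e -> exists q, [/\ E q, q != p & mdist p q <= e]) ->
  (exists2 p, E p & p (pickle u) != 0) ->
  exists v, [/\ prefix u v, v != u & exists2 p, E p & p (pickle v) != 0].
Proof.
move=> EC acc [p Ep pu]; apply: contrapT => noext.
have maxu r : E r -> r (pickle u) != 0 -> r = node u.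
  move=> Er ru; apply: closure_node_maximal (EC _ Er) ru _ => v uv vu.
  apply/eqP; apply: contraT => rv; case: noext.
  by exists v; split=> //; exists r.
have w0 := @weight_gt0 R u.
have [q [Eq qp pq]] := acc _ _ Ep (divr_gt0 w0 (ltr0Sn R 1)).
move/eqP: qp; apply; rewrite (maxu _ Ep pu); apply: (maxu _ Eq).
apply: contraTneq pq => qu; rewrite -ltNge.
apply: lt_le_trans (coord_le_norm _ (pickle u)).
rewrite ell1B qu subr0 (maxu _ Ep pu) node_coord prefix_refl gtr0_norm//.
by rewrite ltr_pdivrMr// ltr_pMr// ltr1n.
Qed.

End node_closure.

(** * Lower dimension of the nodes over a branch *)

Section branches.
Context {R : realType}.

Definition over_branch (y : nat -> nat) : set (seq letter) :=
  [set s | map fst s = mkseq y (size s)].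

Lemma over_branch_rcons y s mj : over_branch y s ->
  over_branch y (rcons s (y (size s), mj)).
Proof. by rewrite /over_branch/= map_rcons size_rcons mkseqS => ->. Qed.

Lemma over_branch_prefix y p t : over_branch y (p ++ t) -> over_branch y p.
Proof.
rewrite /over_branch/= => /(congr1 (take (size p))).
rewrite map_cat take_size_cat ?size_map// => ->.
by rewrite take_mkseq// size_cat leq_addr.
Qed.

Lemma diam_node_le (D : set (seq letter)) : (diam (@node R @` D) <= 1)%E.
Proof.
rewrite /diam ge_max lee_fin ler01/=.
apply: ge_ereal_sup => _ [[_ _] /= [[s _ <-] [t _ <-]] <-].
rewrite lee_fin ell1_mdistE -(subrKA (node [::])).
apply: le_trans (ler_normD _ _) _; rewrite [X in _ + X]distrC.
have := @node_cat_dist R [::] s; have := @node_cat_dist R [::] t => /=.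
rewrite /weight/level/= expr0 invr1; lra.
Qed.

(** Take the least [N] satisfying the first inequality: [s <= 1] excludes [N = 0], and minimality
    gives the second. *)
Lemma exists_scale (s : R) : 0 < s -> s <= 1 ->
  exists2 N, (0 < N)%N & 3 * 4 ^- N <= s < 12 * 4 ^- N.
Proof.
move=> s0 s1.
have exN : exists N, 3 * 4 ^- N <= s.
  exists (Num.truncn (3 / s)).+1; rewrite ler_pdivrMr ?exprn_gt0//.
  rewrite mulrC -ler_pdivrMr//.
  have /ltW/le_trans := @truncnS_gt R (3 / s); apply.
  by rewrite -natrX ler_nat ltnW// ltn_expl.
have [N Ns Nmin] := ex_minnP exN; exists N.
  by rewrite lt0n; apply: contraTneq Ns => ->; rewrite expr0 -ltNge; lra.
rewrite Ns/=; case: N {Ns} Nmin => [|N] Nmin; first by rewrite expr0; lra.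
rewrite ltNge; apply/negP => sN; suff /Nmin : 3 * 4 ^- N <= s by rewrite ltnn.
by apply: le_trans sN; rewrite exprS invfM; lra.
Qed.

Lemma lower_exponent1_branch y : lower_exponent (@node R @` over_branch y) 1.
Proof.
apply: (@lower_exponent1_separated _ _ _ 12) => // _ s [r yr <-] s0 sE.
have [N N0 /andP[Ns sN]] :
    exists2 N, (0 < N)%N & 3 * 4 ^- N <= s < 12 * 4 ^- N.
  by apply: exists_scale => //; rewrite -lee_fin (le_trans sE) ?diam_node_le.
have [p [t [rE pN rp]]] := @node_truncation R N r N0.
have yp : over_branch y p by apply: (@over_branch_prefix _ _ t); rewrite -rE.
(* The middle entry raises the level to exactly [N]; varying [j] gives infinitely many nodes at
   mutual distance at least [4 ^- N], which exceeds [s / 12]. *)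
pose v j := rcons p (y (size p), ((N - level p).-1, j)).
have levelv j : level (v j) = N.
  by rewrite level_rcons/= prednK ?subn_gt0// subnKC// ltnW.
exists (fun j => node (v j)); split=> [j|i j ij].
  split; first by exists (v j) => //; exact: over_branch_rcons.
  (* Through [node p] the distance is at most [(4 / 3 + 1) * 4 ^- N], below [3 * 4 ^- N <= s]. *)
  rewrite ell1_mdistE -(subrKA (node p)).
  apply: le_trans (ler_normD _ _) _; rewrite [X in _ + X]distrC.
  by rewrite node_rcons_dist /weight levelv; lra.
apply: (lt_le_trans sN); rewrite ler_pM2l//.
have := @node_sep R (v i) (v j); rewrite /weight levelv; apply.
apply: contra ij => /prefixP[u /eqP]; case/lastP: u => [|u c].
  by rewrite cats0 /v eqseq_rcons eqxx/= => /eqP[->].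
by move=> /eqP/(congr1 size); rewrite size_cat !size_rcons -[LHS]addn0 => /addnI.
Qed.

Lemma dimL_branch y : (1 <= dimL (@node R @` over_branch y))%E.
Proof.
rewrite /dimL; case: asboolP => [_|[]].
  by apply: ereal_sup_ubound; exists 1 => //; exact: lower_exponent1_branch.
exists (node [::]), (node [:: (y 0%N, (0, 0)%N)]); split.
- by exists [::].
- by exists [:: (y 0%N, (0, 0)%N)].
- move=> /(congr1 (fun x : ell1 R => x (pickle [:: (y 0%N, (0, 0)%N)]))).
  rewrite !node_coord prefix_refl/= => /esym/eqP.
  by rewrite (negPf (weight_neq0 _)).
Qed.

End branches.

(** * Trees coded by points of the Cantor space *)

Section trees.
Context {R : realType}.

(** The first components of the letters trace a node of the tree whose infinite branches witness
    [diagonal_analytic x]; the other components are free. *)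
Definition tree_nodes (x : nat -> bool) : set (seq letter) :=
  [set s | forall k, (k <= size s)%N ->
    x (pickle (mkseq x k, take k (map fst s)))].

Lemma locally_constant_tree_nodes s :
  locally_constant [set x | tree_nodes x s].
Proof.
move=> x.
pose code k := (pickle (mkseq x k, take k (map fst s))).
exists (maxn (size s) (\max_(k < (size s).+1) (code k).+1)) => x' xx'.
suff codeE k : (k <= size s)%N ->
    x' (pickle (mkseq x' k, take k (map fst s))) = x (code k).
  by split=> xs k ks; move: (xs k ks); rewrite codeE.
move=> ks; have /agree_mkseq -> : agree k x x'.
  by apply: agree_le xx'; rewrite leq_max ks.
apply: xx'; rewrite leq_max; apply/orP; right.
exact: (leq_bigmax (F := fun k : 'I_(size s).+1 => (code k).+1)
  (Ordinal (ks : k < (size s).+1)%N)).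
Qed.

Definition tree_set (x : nat -> bool) : set (ell1 R) :=
  closure (node @` tree_nodes x).

Lemma dimML_tree_ge1 x : diagonal_analytic x -> (1 <= dimML (tree_set x))%E.
Proof.
move=> [y xy]; apply: le_trans (dimL_branch y) _; apply: ereal_sup_ubound.
exists (node @` over_branch y) => //=.
apply: subset_trans (@subset_closure _ _); apply: image_subset => s ys k ks.
suff -> : take k (map fst s) = mkseq y k by [].
by rewrite ys take_mkseq.
Qed.

Lemma diagonal_analytic_chain x (u : nat -> seq letter) :
  (forall n, tree_nodes x (u n)) ->
  (forall n, prefix (u n) (u n.+1) /\ u n.+1 != u n) -> diagonal_analytic x.
Proof.
move=> xu uS.
have u_le m n : (m <= n)%N -> prefix (u m) (u n).
  elim: n => [|n IHn]; first by rewrite leqn0 => /eqP->; exact: prefix_refl.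
  rewrite leq_eqVlt => /orP[/eqP->|]; first exact: prefix_refl.
  by rewrite ltnS => /IHn /prefix_trans; apply; case: (uS n).
have size_u n : (n <= size (u n))%N.
  elim: n => // n IHn; have [/prefixP[t ->]] := uS n.
  case: t => [|c t _]; first by rewrite cats0 eqxx.
  by rewrite size_cat/= addnS ltnS (leq_trans IHn) ?leq_addr.
(* Entry [k] is read off [u k.+1], which is long enough for the default 0 not to occur. *)
exists (fun k => nth 0%N (map fst (u k.+1)) k) => n.
suff -> : mkseq (fun k => nth 0%N (map fst (u k.+1)) k) n =
          take n (map fst (u n)) by apply: xu.
apply: (@eq_from_nth _ 0%N).
  by rewrite size_mkseq size_take size_map; case: ltngtP (size_u n).
move=> i; rewrite size_mkseq => ni; rewrite nth_mkseq// nth_take//.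
have /prefixP[t ->] := u_le _ _ ni.
by rewrite map_cat nth_cat size_map size_u.
Qed.

Lemma dimML_tree_le0 x : ~ diagonal_analytic x -> (dimML (tree_set x) <= 0)%E.
Proof.
move=> nAx; apply: ge_ereal_sup => _ [E /= Ex <-].
rewrite leNgt; apply/negP; rewrite /dimL; case: asboolP; last by rewrite ltxx.
move=> [p [q [Ep Eq /eqP pq]]] /ereal_sup_gt[_ [a aE <-]].
rewrite lte_fin => a0.
have acc := lower_exponent_no_isolated a0 aE Ep Eq pq.
(* [P u] says that some point of [E] passes through [u]; iterating the extension [f] from the empty
   sequence yields an infinite chain. *)
pose P (u : seq letter) := exists2 p, E p & p (pickle u) != 0.
have /choice[f fP] : forall u, exists v,
    P u -> [/\ prefix u v, v != u & P v].
  move=> u; have [Pu|nPu] := pselect (P u); last by exists [::].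
  by have [v] := no_isolated_extension Ex acc Pu; exists v.
have P0 : P [::].
  exists p => //; have [s [_ -> _]] := closure_node_coord [::] [::] (Ex _ Ep).
  by rewrite node_coord_neq0 prefix0s.
have Pu n : P (iter n f [::]) by elim: n => //= n /fP[].
apply: nAx; apply: (@diagonal_analytic_chain _ (fun n => iter n f [::])) => n.
  have [r Er] := Pu n.
  have [s [xs -> _]] := closure_node_coord (iter n f [::]) [::] (Ex _ Er).
  rewrite node_coord_neq0 => /prefixP[t sE] k ks.
  have := xs k; rewrite sE size_cat map_cat takel_cat ?size_map//; apply.
  exact: leq_trans ks (leq_addr _ _).
by have [] := fP _ (Pu n).
Qed.

Definition tree_point (x : nat -> bool) : effros (ell1 R) :=
  exist _ (tree_set x) (@closed_closure _ _).

Lemma analytic_tree_point_preimage (B : set (effros (ell1 R))) :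
  measurable B -> analytic (tree_point @^-1` B).
Proof.
move: B; apply: (@analytic_preimage_measurable _ (effros (ell1 R))
  (@hitting_sets (ell1 R)) tree_point) => //.
move=> _ [U oU <-].
(* An open set meets the closure iff it contains a node, so the preimage is a countable union of
   clopen sets indexed by codes of sequences. *)
pose V n := if unpickle n is Some s
  then [set x | tree_nodes x s /\ U (@node R s)] else set0.
have lcV n : locally_constant (V n).
  rewrite /V; case: unpickle => [s|]; last by exists 0%N.
  move=> x; have [m mP] := locally_constant_tree_nodes s x; exists m => x' /mP.
  by rewrite /= => ->.
have -> : tree_point @^-1` [set F | sval F `&` U !=set0] = \bigcup_n V n.
  apply/seteqP; split=> x /=.
    move=> [p [xp Up]].
    have [_ [[s xs <-] Us]] := xp _ (open_nbhs_nbhs (conj oU Up)).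
    by exists (pickle s) => //; rewrite /V pickleK.
  move=> [n _]; rewrite /V; case: unpickle => // s [xs Us].
  by exists (node s); split=> //; apply: subset_closure; exists s.
split; first by apply: analytic_bigcup => n; exact: locally_constant_analytic.
rewrite setC_bigcup; apply: analytic_bigcap => n.
exact/locally_constant_analytic/locally_constantC.
Qed.

End trees.

Theorem theorem5p1 (R : realType) :
  ~ measurable_fun [set: effros (ell1 R)]
      (fun F : effros (ell1 R) => dimML (sval F) : \bar R).
Proof.
move=> mdim; apply: diagonal_analytic_coanalytic.
(* The dimension is either at least 1 or at most 0, so the preimage of this ray is exactly the
   complement of [diagonal_analytic]. *)
have /(_ measurableT _ (emeasurable_itv `]-oo, 0%E])) := mdim.
rewrite setTI => /analytic_tree_point_preimage.
suff -> : tree_point @^-1` ((fun F : effros (ell1 R) => dimML (sval F)) @^-1`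
    [set` `]-oo, 0%E]]) = ~` diagonal_analytic by [].
apply/seteqP; split=> x /=; rewrite in_itv/=.
  move=> dim0 /(@dimML_tree_ge1 R) dim1.
  by have := le_trans dim1 dim0; rewrite lee_fin ler10.
exact: dimML_tree_le0.
Qed.
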